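(* Let $n\geqslant 4$ be an integer with $\gcd(n,3)=1$. Then $$\sum_{k=0}^{n-1}\frac{(q^{-1},q^{-2};q^3)_k}{(q^3;q^3)_k^2}\,q^{3k}\equiv 0\pmod{\Phi_n(q)^2}.$$
   Context: Here $q$ is an indeterminate. Notation: $(a;q)_k=(1-a)(1-aq)\cdots(1-aq^{k-1})$ for $k\ge 1$, $(a;q)_0=1$, and $(a_1,\ldots,a_m;q)_k=(a_1;q)_k\cdots(a_m;q)_k$ (so $(x;q^3)_k=\prod_{i=0}^{k-1}(1-xq^{3i})$). $\Phi_n(q)$ is the $n$-th cyclotomic polynomial in $q$. For a rational function $A(q)$ and a polynomial $P(q)$, $A(q)\equiv 0\pmod{P(q)}$ means that $A(q)=P(q)U(q)/V(q)$ with polynomials $U,V$ (over $\mathbb{Q}$), where $V$ is relatively prime to $P$. *)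

(* Defs.v *)
From HB Require Import structures.
From mathcomp Require Import all_boot all_order all_algebra all_field.

Set Implicit Arguments.
Unset Strict Implicit.
Unset Printing Implicit Defensive.

Import GRing.Theory.
Local Open Scope ring_scope.

(* The base is a parameter: (a; q^3)_k is [qpoch a (q ^+ 3) k]. *)
Definition qpoch (R : comNzRingType) (a b : R) (k : nat) : R :=
  \prod_(i < k) (1 - a * b ^+ i).

Definition ratfun_of_poly (p : {poly rat}) : {fraction {poly rat}} :=
  FracField.tofrac p.

(* q is not a root of unity in Q(q), so no factor 1 - q ^+ m (m > 0) vanishes. *)
Definition qvar : {fraction {poly rat}} := ratfun_of_poly 'X.

(* [Cyclotomic n] lives in {poly int}; congruences are taken over Q. *)
Definition cyclotomicQ (n : nat) : {poly rat} :=
  map_poly (intr : int -> rat) (Cyclotomic n).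

Definition ratfun_eq0_mod (A : {fraction {poly rat}}) (P : {poly rat}) : Prop :=
  exists U V : {poly rat},
    [/\ V != 0, coprimep V P &
        A = ratfun_of_poly P * (ratfun_of_poly U / ratfun_of_poly V)].

(* Main.v *)
Require Import Defs.
From mathcomp Require Import all_boot all_order all_algebra all_field.
From mathcomp Require Import ring.

(** The truncated sum has a closed form, and its numerator visibly contains
    the cyclotomic polynomial twice.

    Put p = q^3, a = q^-1, b = q^-2, so that a b p = 1. For any parameters bound
    by this relation the summand is Gosper-summable: it is a difference
    T (k + 1) - T k, where
      T k = (c0 + c1 p^k) (a;p)_k (b;p)_k / (p;p)_(k-1)^2
    and c0, c1 do not depend on k. Solving for c0 and c1 leads to the common
    denominator p (1 - a)^2 (1 - b)^2, and T 0 = 0 because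
    1 / (p;p)_(k-1) = (1 - p^k) / (p;p)_k vanishes at k = 0; this is
    [qpoch_sum_closed_form].

    It remains to see where Phi_n divides in Q(q). An element q^r - q^s is
    divisible by Phi_n if r = s mod n, and is prime to it otherwise. Since 3 is
    invertible mod n, each of (q^-1;q^3)_n and (q^-2;q^3)_n has a factor
    1 - q^(3i-r) with n | 3i - r (r = 1, 2), hence contributes one Phi_n
    ([qpoch_qvar_divisible]). The denominators 1 - q^-1, 1 - q^-2 and
    (q^3;q^3)_(n-1) only involve exponents that n does not divide, so they are
    invertible in the local ring at Phi_n ([regular_inv_one_sub],
    [regular_inv_qpoch]), and Phi_n^2 survives. *)

Import GRing.Theory.
Local Open Scope ring_scope.

Lemma qpochS (R : comNzRingType) (a p : R) (k : nat) :
  qpoch a p k.+1 = qpoch a p k * (1 - a * p ^+ k).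
Proof. by rewrite /qpoch big_ord_recr. Qed.

Lemma qpoch1 (R : comNzRingType) (a p : R) : qpoch a p 1 = 1 - a.
Proof. by rewrite /qpoch big_ord_recr big_ord0 /= mul1r expr0 mulr1. Qed.

(** Indefinite summation with a b p = 1 (the antidifference is found by
    Gosper's method). Both sides are multiplied by p (1 - a)^2 (1 - b)^2, so
    that the degenerate values a = 1 and b = 1 need no exclusion. *)
Lemma qpoch_sum_closed_form (F : fieldType) (a b p : F) (m : nat) :
    a * b * p = 1 -> (forall k, (0 < k <= m)%N -> p ^+ k != 1) ->
  p * (1 - a) ^+ 2 * (1 - b) ^+ 2 *
    \sum_(0 <= k < m.+1) qpoch a p k * qpoch b p k / qpoch p p k ^+ 2 * p ^+ k
  = (2 - p * (a + b) + (p - 1) * p ^+ m)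
      * (qpoch a p m.+1 * qpoch b p m.+1) / qpoch p p m ^+ 2.
Proof.
move=> abp; elim: m => [|m IHm] p_neq1.
  rewrite big_nat1 !qpoch1 /qpoch !big_ord0.
  have -> : 2 - p * (a + b) + (p - 1) * p ^+ 0 = p * (1 - a) * (1 - b).
    by rewrite expr0; ring: abp.
  by rewrite expr0 expr1n !divr1 !mulr1; ring.
rewrite big_nat_recr //= mulrDr IHm; last first.
  by move=> k /andP[k_gt0 le_km]; rewrite p_neq1 // k_gt0 leqW.
have nz k : (k <= m.+1)%N -> qpoch p p k != 0.
  move=> le_km; apply/prodf_neq0 => i _; rewrite -exprS subr_eq0 eq_sym.
  by rewrite p_neq1 //= (leq_trans (ltn_ord i)).
have nzm := nz m (leqnSn m); have := nz m.+1 (leqnn _).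
rewrite (qpochS _ a p m.+1) (qpochS _ b p m.+1) !(qpochS _ p p m).
rewrite -[p * p ^+ m]exprS mulf_eq0 => /norP[_ nzQ].
set A := qpoch a p m.+1; set B := qpoch b p m.+1; set D := qpoch p p m in nzm *.
(* What the induction step amounts to after removing the common factor
   (a;p)_(m+1) (b;p)_(m+1) / (p;p)_(m+1)^2. *)
have step_eq : (2 - p * (a + b) + (p - 1) * p ^+ m) * (1 - p ^+ m.+1) ^+ 2
   + p * (1 - a) ^+ 2 * (1 - b) ^+ 2 * p ^+ m.+1
  = (2 - p * (a + b) + (p - 1) * p ^+ m.+1)
    * ((1 - a * p ^+ m.+1) * (1 - b * p ^+ m.+1)).
  by rewrite (exprS p m); move: (p ^+ m) => Q; ring: abp.
transitivity (A * B / (D * (1 - p ^+ m.+1)) ^+ 2 *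
   ((2 - p * (a + b) + (p - 1) * p ^+ m) * (1 - p ^+ m.+1) ^+ 2
   + p * (1 - a) ^+ 2 * (1 - b) ^+ 2 * p ^+ m.+1)).
  by move: (p ^+ m.+1) (p ^+ m) nzQ => Q Q' nzQ; field; rewrite nzm nzQ.
by rewrite step_eq; move: (_ ^+ 2)^-1 => E; move: (p ^+ m.+1) => Q; ring.
Qed.

(** The case a = q^-1, b = q^-2, p = q^3, where p (a + b) = q^2 + q is a
    polynomial. Divisions are products with inverses, because divisibility by
    Phi_n and regularity at Phi_n are decided factor by factor. *)
Lemma qpoch_sum_base3 (F : fieldType) (q : F) (m : nat) :
    q != 0 -> (forall k, (0 < k)%N -> q ^+ k != 1) ->
  \sum_(0 <= k < m.+1)
     qpoch q^-1 (q ^+ 3) k * qpoch (q ^- 2) (q ^+ 3) k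
       / qpoch (q ^+ 3) (q ^+ 3) k ^+ 2 * q ^+ (3 * k)
  = qpoch (q ^- 1) (q ^+ 3) m.+1 * qpoch (q ^- 2) (q ^+ 3) m.+1
    * ((2 - q ^+ 2 - q + (q ^+ 3 - 1) * q ^+ (3 * m)) * (q ^+ 3)^-1
       * (1 - q ^- 1)^-1 ^+ 2 * (1 - q ^- 2)^-1 ^+ 2
       * (qpoch (q ^+ 3) (q ^+ 3) m)^-1 ^+ 2).
Proof.
move=> q_neq0 q_neq1.
have abp : q^-1 * q ^- 2 * q ^+ 3 = 1 by field; rewrite q_neq0.
have p_neq1 k : (0 < k <= m)%N -> (q ^+ 3) ^+ k != 1.
  by case/andP=> k_gt0 _; rewrite -exprM q_neq1 // muln_gt0.
have one_sub_neq0 r : (0 < r)%N -> 1 - q ^- r != 0.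
  by move=> r_gt0; rewrite subr_eq0 eq_sym invr_eq1 q_neq1.
have na := one_sub_neq0 1 isT; have nb := one_sub_neq0 2 isT.
have C_neq0 : q ^+ 3 * (1 - q ^- 1) ^+ 2 * (1 - q ^- 2) ^+ 2 != 0.
  by rewrite !mulf_neq0 ?expf_neq0.
apply: (mulfI C_neq0).
under eq_bigr => k _ do rewrite exprM.
rewrite (qpoch_sum_closed_form _ _ _ _ m abp p_neq1) -[q^-1]/(q ^- 1).
have -> : q ^+ 3 * (q ^- 1 + q ^- 2) = q ^+ 2 + q by field; rewrite q_neq0.
rewrite opprD addrA exprM; set N := 2 - _ - _ + _.
rewrite !exprVn; move: (qpoch _ _ m ^+ 2)^-1 => E.
move: (qpoch _ _ _) (qpoch _ _ _) => A B.
move: (1 - q ^- 1) (1 - q ^- 2) N na nb => a b N na nb.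
by field; rewrite na nb q_neq0.
Qed.

(** The complex roots of Phi_n are the primitive n-th roots of unity, and
    coprimality is insensitive to extending the base field. *)
Lemma coprimep_cyclotomicQ (P : {poly rat}) (n : nat) : (0 < n)%N ->
    (forall z : algC, n.-primitive_root z -> (map_poly ratr P).[z] != 0) ->
  coprimep P (cyclotomicQ n).
Proof.
move=> n_gt0 Pz; rewrite -(coprimep_map (ratr : {rmorphism rat -> algC})).
rewrite coprimep_sym; apply: Pdiv.ClosedField.root_coprimep => z.
have [w prim_w] := C_prim_root_exists n_gt0.
have -> : map_poly ratr (cyclotomicQ n) = cyclotomic w n.
  rewrite -(Cintr_Cyclotomic prim_w) /cyclotomicQ -map_poly_comp.
  by apply: eq_map_poly => x /=; rewrite ratr_int.
by rewrite (root_cyclotomic prim_w) => /Pz.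
Qed.

Lemma coprimep_cyclotomicQ_subXn (n a b : nat) : (0 < n)%N ->
  a != b %[mod n] -> coprimep ('X^a - 'X^b) (cyclotomicQ n).
Proof.
move=> n_gt0 neq_ab; apply: coprimep_cyclotomicQ => // z prim_z.
by rewrite rmorphB /= !map_polyXn !hornerE subr_eq0 (eq_prim_root_expr prim_z).
Qed.

Lemma coprimep_cyclotomicQ_X (n : nat) : (0 < n)%N ->
  coprimep 'X (cyclotomicQ n).
Proof.
move=> n_gt0; apply: coprimep_cyclotomicQ => // z prim_z.
by rewrite map_polyX hornerX (prim_root_eq0 prim_z) -lt0n.
Qed.

(** Phi_n divides X^n - 1, modulo which exponents only matter mod n. *)
Lemma dvdp_cyclotomicQ_subXn (n a b : nat) : (0 < n)%N ->
  a = b %[mod n] -> cyclotomicQ n %| 'X^a - 'X^b.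
Proof.
move=> n_gt0 eq_ab.
have dvdXn1 : cyclotomicQ n %| 'X^n - 1.
  have -> : 'X^n - 1 = map_poly intr ('X^n - 1 : {poly int}) :> {poly rat}.
    by rewrite rmorphB /= map_polyXn rmorph1.
  rewrite -(prod_Cyclotomic n_gt0) (big_rem n) -?dvdn_divisors //=.
  by rewrite rmorphM dvdp_mulr.
have red c : cyclotomicQ n %| 'X^c - 'X^(c %% n).
  rewrite {1}(divn_eq c n) exprD mulnC exprM -[X in _ - X]mul1r -mulrBl.
  by rewrite -[X in _ - X](expr1n _ (c %/ n)) subrXX -mulrA dvdp_mulr.
by rewrite -(subrKA 'X^(a %% n)) {2}eq_ab -[X in _ + X]opprB dvdp_sub.
Qed.

(** Membership in the localization of Q[q] at P: being 0 mod P, in the sense of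
    [ratfun_eq0_mod], is being P times a regular element. *)
Definition regular_at (P : {poly rat}) (A : {fraction {poly rat}}) : Prop :=
  exists U V : {poly rat},
    [/\ V != 0, coprimep V P & A = ratfun_of_poly U / ratfun_of_poly V].

Lemma regular_poly (P U : {poly rat}) : regular_at P (ratfun_of_poly U).
Proof.
by exists U, 1; rewrite oner_neq0 coprime1p /ratfun_of_poly tofrac1 divr1.
Qed.

Lemma regular_inv (P V : {poly rat}) : V != 0 -> coprimep V P ->
  regular_at P (ratfun_of_poly V)^-1.
Proof. by exists 1, V; rewrite /ratfun_of_poly tofrac1 div1r. Qed.

Lemma regularM (P : {poly rat}) (A B : {fraction {poly rat}}) :
  regular_at P A -> regular_at P B -> regular_at P (A * B).
Proof.
move=> [U [V [V0 VP ->]]] [U' [V' [V'0 V'P ->]]].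
exists (U * U'), (V * V'); split; first by rewrite mulf_neq0.
  by rewrite coprimepMl VP.
by rewrite /ratfun_of_poly !tofracM mulf_div.
Qed.

Lemma regular_prod (P : {poly rat}) (I : Type) (s : seq I) (Q : pred I)
    (F : I -> {fraction {poly rat}}) :
  (forall i, Q i -> regular_at P (F i)) ->
  regular_at P (\prod_(i <- s | Q i) F i).
Proof.
move=> regF; apply: big_ind => //; last exact: regularM.
by rewrite -(tofrac1 {poly rat}); apply: regular_poly.
Qed.

Lemma qvar_neq0 : qvar != 0.
Proof. by rewrite /qvar /ratfun_of_poly tofrac_eq0 polyX_eq0. Qed.

Lemma one_sub_qvar_frac (r i : nat) :
  1 - qvar ^- r * (qvar ^+ 3) ^+ i
  = ratfun_of_poly ('X^r - 'X^(3 * i)) / ratfun_of_poly 'X^r.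
Proof.
rewrite -exprM /ratfun_of_poly tofracB !tofracXn -/(ratfun_of_poly _) -/qvar.
by rewrite mulrBl divff ?expf_neq0 ?qvar_neq0 // [_ / _]mulrC.
Qed.

Lemma regular_inv_Xn (n r : nat) : (0 < n)%N ->
  regular_at (cyclotomicQ n) (ratfun_of_poly 'X^r)^-1.
Proof.
move=> n_gt0; apply: regular_inv; first by rewrite expf_neq0 ?polyX_eq0.
exact/coprimep_expl/coprimep_cyclotomicQ_X.
Qed.

Lemma subXn_neq0 (a b : nat) : a != b -> 'X^a - 'X^b != 0 :> {poly rat}.
Proof.
apply: contra_neq => /eqP; rewrite subr_eq0 => /eqP eqX.
by apply: succn_inj; rewrite -(size_polyXn rat a) eqX size_polyXn.
Qed.

Lemma regular_inv_subXn (n a b : nat) : (0 < n)%N -> a != b %[mod n] ->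
  regular_at (cyclotomicQ n) (ratfun_of_poly ('X^a - 'X^b))^-1.
Proof.
move=> n_gt0 neq_ab; apply: regular_inv; last exact: coprimep_cyclotomicQ_subXn.
by apply: subXn_neq0; apply: contra_neq neq_ab => ->.
Qed.

(** The multiple of 3 lying over r mod n is given by the Chinese remainder
    theorem for the moduli n and 3. *)
Lemma exists_mul3_eqmod (n r : nat) : (0 < n)%N -> coprime n 3 ->
  exists2 i, (i < n)%N & 3 * i = r %[mod n].
Proof.
move=> n_gt0 co_n3; exists (chinese n 3 r 0 %/ 3 %% n)%N.
  by rewrite ltn_mod.
rewrite modnMmr mulnC divnK ?chinese_modl //.
by rewrite /dvdn chinese_modr ?mod0n.
Qed.

(** Among the factors 1 - q^(3i-r) with i < n, exactly one has an exponent
    divisible by n, because i -> 3i permutes the residues mod n. *)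
Lemma qpoch_qvar_divisible (n r : nat) : (0 < n)%N -> coprime n 3 ->
  exists2 R, regular_at (cyclotomicQ n) R
    & qpoch (qvar ^- r) (qvar ^+ 3) n = ratfun_of_poly (cyclotomicQ n) * R.
Proof.
move=> n_gt0 co_n3; have [i lt_in eq_i] := exists_mul3_eqmod n r n_gt0 co_n3.
have /dvdpP[U defU] := dvdp_cyclotomicQ_subXn n r (3 * i) n_gt0 (esym eq_i).
rewrite /qpoch (bigD1 (Ordinal lt_in)) //= one_sub_qvar_frac defU.
rewrite [ratfun_of_poly (U * _)]tofracM mulrAC -!mulrA mulrCA.
rewrite -/(ratfun_of_poly _).
eexists; last by reflexivity.
apply: regularM; first exact: regular_poly.
apply: regularM; last exact: regular_inv_Xn.
apply: regular_prod => j _; rewrite one_sub_qvar_frac.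
by apply: regularM; [apply: regular_poly | apply: regular_inv_Xn].
Qed.

(** The exponents 3(i+1) of the factors satisfy 0 < i+1 < n, so that n, being
    prime to 3, divides none of them. *)
Lemma regular_inv_qpoch (n m : nat) : (m < n)%N -> coprime n 3 ->
  regular_at (cyclotomicQ n) (qpoch (qvar ^+ 3) (qvar ^+ 3) m)^-1.
Proof.
move=> lt_mn co_n3; have n_gt0 := leq_ltn_trans (leq0n m) lt_mn.
rewrite /qpoch -prodfV; apply: regular_prod => i _.
rewrite -exprS -exprM.
have -> : 1 - qvar ^+ (3 * i.+1) = ratfun_of_poly ('X^0 - 'X^(3 * i.+1)).
  by rewrite /ratfun_of_poly tofracB tofrac1 tofracXn.
apply: regular_inv_subXn => //; rewrite eq_sym mod0n.
rewrite -/(n %| 3 * i.+1)%N Gauss_dvdr // gtnNdvd //.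
by rewrite (leq_ltn_trans _ lt_mn).
Qed.

Lemma regular_inv_one_sub (n r : nat) : (0 < n)%N -> ~~ (n %| r)%N ->
  regular_at (cyclotomicQ n) (1 - qvar ^- r)^-1.
Proof.
move=> n_gt0 ndvd_nr.
rewrite -[qvar ^- r]mulr1 -(expr0 (qvar ^+ 3)) one_sub_qvar_frac invf_div.
apply: regularM; first exact: regular_poly.
by apply: regular_inv_subXn => //; rewrite mod0n.
Qed.

Theorem theorem4 (n : nat) (n_ge4 : (4 <= n)%N) (n_coprime3 : gcdn n 3 = 1%N) :
  ratfun_eq0_mod
    (\sum_(0 <= k < n)
       qpoch qvar^-1 (qvar ^+ 3) k * qpoch (qvar ^- 2) (qvar ^+ 3) k
         / qpoch (qvar ^+ 3) (qvar ^+ 3) k ^+ 2 * qvar ^+ (3 * k))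
    (cyclotomicQ n ^+ 2).
Proof.
have co_n3 : coprime n 3 by apply/eqP.
have n_gt0 : (0 < n)%N by apply: leq_trans n_ge4.
set Phi := cyclotomicQ n.
suff [R [U [V [V_neq0 coVPhi ->]]] ->] : exists2 R, regular_at Phi R &
    \sum_(0 <= k < n)
       qpoch qvar^-1 (qvar ^+ 3) k * qpoch (qvar ^- 2) (qvar ^+ 3) k
         / qpoch (qvar ^+ 3) (qvar ^+ 3) k ^+ 2 * qvar ^+ (3 * k)
    = ratfun_of_poly (Phi ^+ 2) * R.
  by exists U, V; split=> //; apply: coprimep_expr.
have [Ra regRa defA] := qpoch_qvar_divisible n 1 n_gt0 co_n3.
have [Rb regRb defB] := qpoch_qvar_divisible n 2 n_gt0 co_n3.
have small r : (0 < r <= 2)%N -> ~~ (n %| r)%N.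
  case/andP=> r_gt0 r_le2.
  by rewrite gtnNdvd // (leq_trans _ n_ge4) // ltnS ltnW.
have q_neq1 k : (0 < k)%N -> qvar ^+ k != 1.
  move=> k_gt0; rewrite -subr_eq0 /qvar /ratfun_of_poly -tofracXn -tofrac1.
  by rewrite -tofracB tofrac_eq0 -(expr0 'X) subXn_neq0 // -lt0n.
have := qpoch_sum_base3 _ _ n.-1 qvar_neq0 q_neq1; rewrite prednK // => ->.
rewrite defA defB -/Phi (mulrACA (ratfun_of_poly Phi)) -expr2.
rewrite -(mulrA (ratfun_of_poly Phi ^+ 2)).
rewrite [ratfun_of_poly (Phi ^+ 2)]tofracXn -/(ratfun_of_poly Phi).
eexists; last by reflexivity.
have regX2 A : regular_at Phi A -> regular_at Phi (A ^+ 2).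
  by move=> regA; rewrite expr2; apply: regularM.
have -> : 2 - qvar ^+ 2 - qvar + (qvar ^+ 3 - 1) * qvar ^+ (3 * n.-1)
    = ratfun_of_poly (2 - 'X^2 - 'X + ('X^3 - 1) * 'X^(3 * n.-1)).
  rewrite /ratfun_of_poly tofracD tofracM !tofracB !tofracXn tofrac1.
  by rewrite (tofracMn 2) tofrac1.
apply: regularM; first exact: regularM.
apply: regularM; last by apply/regX2/regular_inv_qpoch; rewrite // ltn_predL.
(* Without n > 2, Phi_n would divide the denominator (1 - q^-1) (1 - q^-2). *)
apply: regularM; last by apply/regX2/regular_inv_one_sub; rewrite ?small.
apply: regularM; last by apply/regX2/regular_inv_one_sub; rewrite ?small.
apply: regularM; first exact: regular_poly.
by rewrite /qvar /ratfun_of_poly -tofracXn; apply: (regular_inv_Xn n 3).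
Qed.
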